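(* In the setting described in the context, the mapping $\triangleright: A\otimes M\to M$ given by $$a\triangleright m=a_{(1)}\,m\,S(a_{(2)})$$ (products taken in $M_1$) is a weak Hopf algebra action of $A$ on $M$; that is, it takes values in $M$ and makes $M$ a left $A$-module algebra.
   Context: Conventions. $k$ is a field; algebras are unital associative $k$-algebras; summation over repeated indices (finite sums) is understood; $C_X(Y)$ is the centralizer of $Y$ in $X$; Sweedler notation $\Delta(h)=h_{(1)}\otimes h_{(2)}$ is used. Extensions. An algebra extension $M/N$ is Frobenius if there are an $N$-$N$-bimodule map $E:M\to N$ (Frobenius homomorphism) and finite families $\{x_i\},\{y_i\}$ in $M$ (dual bases for $E$) with $E(mx_i)y_i=m=x_iE(y_im)$ for all $m\in M$. It is strongly separable of index $\lambda^{-1}$ if also $E(1)=1$ and $x_iy_i=\lambda^{-1}1$ with $0\neq\lambda\in k$. It is a Markov extension if moreover there is a trace $T:N\to k$ (Markov trace) with $T(1)=1$ such that $T_0:=T\circ E$ is a trace on $M$. It is a symmetric Markov extension if moreover $E(ux)=E(xu)$ for all $x\in M$, $u\in U:=C_M(N)$. A $k$-algebra is Kanzaki separable if it has a separability element that is symmetric (invariant under the flip). Jones tower. $M_1=M\otimes_N M$, $e_1=1\otimes 1$, elements written $me_1m'=m\otimes m'$, product $(me_1m')(ne_1n')=mE(m'n)e_1n'$, unit $x_ie_1y_i$, $M\subset M_1$ via $m\mapsto mx_ie_1y_i$, and $E_M:M_1\to M$, $E_M(me_1m')=\lambda mm'$. $M_1/M$ is again a symmetric Markov extension of index $\lambda^{-1}$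 with Frobenius homomorphism $E_M$ and Markov trace $T_0$. Iterating for $M_1/M$ gives $M_2=M_1e_2M_1$ and $E_{M_1}:M_2\to M_1$, $E_{M_1}(xe_2y)=\lambda xy$. Put $T_1=T_0\circ E_M$, $T_2=T_1\circ E_{M_1}$ (traces on $M_1$, $M_2$). Centralizers: $U=C_M(N)$, $V=C_{M_1}(M)$, $W=C_{M_2}(M_1)$, $A=C_{M_1}(N)$, $B=C_{M_2}(M)$, $C=C_{M_2}(N)$. $T$ also denotes the restriction of $T_2$ to $C$. Let $\phi:U\to V$, $\phi(u)=x_iue_1y_i$ (an algebra anti-isomorphism). Standing assumptions. (i) $M/N$ is a symmetric Markov extension. (ii) Symmetric product: $x_iy_i=y_ix_i=\lambda^{-1}1$ (alternatively, instead of $y_ix_i=\lambda^{-1}1$ one may assume $T_0|_U=T_1\circ\phi$). (iii) Weak irreducibility: $U$ is a Kanzaki separable $k$-algebra and $T_0|_U$ is a non-degenerate trace. (iv) Depth $2$: $E_M$ has dual bases lying in $A$, and $E_{M_1}$ has dual bases $\{u_j\},\{v_j\}$ lying in $B$. Structure on $A$. $f=f^{(1)}\otimes f^{(2)}$ is the unique symmetric separability element of $V$ and $w=[f^{(1)}T(f^{(2)})]^{-1}\in Z(V)$ (an invertible element of the center of $V$). The bilinear forms $\langle a,b\rangle=\lambda^{-2}T(ae_2e_1wb)$ and $\langle a,b\rangle'=\lambda^{-2}T(be_1e_2wa)$ on $A\times B$ are non-degenerate. Let $S_B:B\to B$ be the linear bijection with $\langle a,b\rangle=\langle a,S_B(b)\rangle'$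 for all $a\in A$, $b\in B$. $A$ is a weak Hopf algebra with its algebra structure and: comultiplication defined by $\langle a_{(1)},b\rangle\langle a_{(2)},b'\rangle=\langle a,bb'\rangle$ for all $b,b'\in B$; counit $\varepsilon(a)=\langle a,1\rangle$; antipode $S:A\to A$ defined by $\langle S(a),b\rangle=\langle a,S_B(b)\rangle$ for all $b\in B$. Module algebras. For a weak Hopf algebra $H$ (an algebra and coalgebra with multiplicative $\Delta$, antipode $S$, and the usual weakened unit/counit axioms) the target counital map is $\varepsilon_t(h)=\varepsilon(1_{(1)}h)1_{(2)}$, where $\Delta(1)=1_{(1)}\otimes1_{(2)}$. A left $H$-module algebra (equivalently, an action of $H$) is an algebra $X$ that is a left $H$-module with $h\cdot(xy)=(h_{(1)}\cdot x)(h_{(2)}\cdot y)$ and $h\cdot1=\varepsilon_t(h)\cdot1$. *)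

(* Defs.v *)
From HB Require Import structures.
From mathcomp Require Import all_boot all_order all_algebra.
From mathcomp Require Import boolp classical_sets.

Set Implicit Arguments.
Unset Strict Implicit.
Unset Printing Implicit Defensive.

Import GRing.Theory.
Local Open Scope ring_scope.

Section Centralizer.
Variables (k : fieldType) (X : algType k).
Implicit Type Y : set X.

Definition centralizer_pred Y : {pred X} :=
  fun x => `[< forall y, Y y -> x * y = y * x >].

Lemma centralizer_predP Y x :
  reflect (forall y, Y y -> x * y = y * x) (x \in centralizer_pred Y).
Proof. exact: asboolP. Qed.

Fact centralizer_subalg_closed Y : subalg_closed (centralizer_pred Y).
Proof.
split=> [|a u v /centralizer_predP cu /centralizer_predP cv
         |u v /centralizer_predP cu /centralizer_predP cv];
  apply/centralizer_predP => y Yy.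
- by rewrite mul1r mulr1.
- by rewrite mulrDl mulrDr -scalerAl -scalerAr cu // cv.
- by rewrite -mulrA cv // mulrA cu // mulrA.
Qed.

HB.instance Definition _ Y :=
  GRing.isSubalgClosed.Build k X (centralizer_pred Y)
    (centralizer_subalg_closed Y).

(* C_X(Y), as a k-algebra in its own right; [val] is the inclusion into X. *)
Record centralizer Y := Centralizer {
  centralizer_val :> X;
  centralizer_valP : centralizer_val \in centralizer_pred Y
}.

HB.instance Definition _ Y := [isSub for @centralizer_val Y].
HB.instance Definition _ Y := [Choice of centralizer Y by <:].
HB.instance Definition _ Y := [SubChoice_isSubAlgebra of centralizer Y by <:].

End Centralizer.

Section TensorProducts.
Variable k : fieldType.

(* Equality of sum_i x_i (x) y_i and sum_j x'_j (x) y'_j in X (x)_k Y, by the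
   universal property: no k-bilinear map tells the two formal sums apart. *)
Definition tensor_eq (X Y : lmodType k) (s t : seq (X * Y)) : Prop :=
  forall (P : lmodType k) (beta : {bilinear X -> Y -> P}),
    \sum_(p <- s) beta p.1 p.2 = \sum_(p <- t) beta p.1 p.2.

Definition is_balanced (N M : algType k) (iota : {lrmorphism N -> M})
    (P : lmodType k) (beta : M -> M -> P) : Prop :=
  forall m n m', beta (m * iota n) m' = beta m (iota n * m').

(* (P, tens) is the tensor product M (x)_N M. *)
Definition is_tensor_product (N M : algType k) (iota : {lrmorphism N -> M})
    (P : lmodType k) (tens : {bilinear M -> M -> P}) : Prop :=
  is_balanced iota tens /\
  forall (Q : lmodType k) (beta : {bilinear M -> M -> Q}),
    is_balanced iota beta ->
    (exists h : {linear P -> Q}, forall m m', h (tens m m') = beta m m') /\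
    (forall h1 h2 : {linear P -> Q},
       (forall m m', h1 (tens m m') = beta m m') ->
       (forall m m', h2 (tens m m') = beta m m') -> h1 =1 h2).

End TensorProducts.

Section Separability.
Variables (k : fieldType) (X : algType k).

Definition symmetric_separability_element (f : seq (X * X)) : Prop :=
  [/\ \sum_(p <- f) p.1 * p.2 = 1,
      forall v : X,
        tensor_eq [seq (v * p.1, p.2) | p <- f] [seq (p.1, p.2 * v) | p <- f]
    & tensor_eq f [seq (p.2, p.1) | p <- f]].

Definition kanzaki_separable : Prop :=
  exists f, symmetric_separability_element f.

Definition is_trace (t : X -> k) : Prop := forall a b, t (a * b) = t (b * a).

Definition nondegenerate_trace (t : X -> k) : Prop :=
  is_trace t /\ forall a, (forall b, t (a * b) = 0) -> a = 0.

End Separability.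

Section Extensions.
Variables (k : fieldType) (N M : algType k) (iota : {lrmorphism N -> M}).

Definition bimodule_map (E : M -> N) : Prop :=
  forall n m n', E (iota n * m * iota n') = n * E m * n'.

Definition dual_bases (E : M -> N) (I : nat) (x y : 'I_I -> M) : Prop :=
  forall m, \sum_i iota (E (m * x i)) * y i = m /\
            \sum_i x i * iota (E (y i * m)) = m.

Definition frobenius_extension (E : M -> N) (I : nat) (x y : 'I_I -> M) :=
  bimodule_map E /\ dual_bases E x y.

(* E 1 = 1 makes iota injective, so that N is a subalgebra of M. *)
Definition strongly_separable (E : M -> N) (I : nat) (x y : 'I_I -> M)
    (lam : k) : Prop :=
  [/\ frobenius_extension E x y, E 1 = 1, lam != 0
    & \sum_i x i * y i = lam^-1 *: 1].

Definition markov_extension (E : M -> N) (I : nat) (x y : 'I_I -> M)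
    (lam : k) (T : N -> k) : Prop :=
  [/\ strongly_separable E x y lam, is_trace T, T 1 = 1
    & is_trace (fun m => T (E m))].

Definition symmetric_markov_extension (E : M -> N) (I : nat)
    (x y : 'I_I -> M) (lam : k) (T : N -> k) : Prop :=
  markov_extension E x y lam T /\
  forall (u : centralizer (range iota)) (m : M),
    E (val u * m) = E (m * val u).

End Extensions.

(* M1 is the basic construction of M/N: its underlying module is M (x)_N M,
   j : M -> M1 is the inclusion, EM : M1 -> M the new Frobenius homomorphism. *)
Record basic_construction (k : fieldType) (N M : algType k)
    (iota : {lrmorphism N -> M}) (E : M -> N) (lam : k)
    (M1 : algType k) (tens : {bilinear M -> M -> M1})
    (j : {lrmorphism M -> M1}) (EM : {linear M1 -> M}) : Prop := {
  bc_tensor : is_tensor_product iota tens;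
  bc_mul : forall m m' n n',
    tens m m' * tens n n' = tens (m * iota (E (m' * n))) n';
  bc_one : forall I (x y : 'I_I -> M), dual_bases iota E x y ->
    1 = \sum_i tens (x i) (y i);
  bc_incl : forall I (x y : 'I_I -> M), dual_bases iota E x y ->
    forall m, j m = \sum_i tens (m * x i) (y i);
  bc_exp : forall m m', EM (tens m m') = lam *: (m * m')
}.

(* Elements of H (x) H are represented by formal sums: [Delta h] is a list of
   pairs (h_(1), h_(2)) whose sum of tensors is the coproduct of h. The notion
   of module algebra over a weak Hopf algebra involves only its product,
   coproduct and counit. *)
Section ModuleAlgebra.
Variables (k : fieldType) (H X : algType k).
Variables (Delta : H -> seq (H * H)) (eps : H -> k).

Definition target_counit (h : H) : H :=
  \sum_(p <- Delta 1) eps (p.1 * h) *: p.2.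

Record left_module_algebra (act : H -> X -> X) : Prop := {
  act_linear_l : forall x, linear (fun h => act h x);
  act_linear_r : forall h, linear (act h);
  act_1 : forall x, act 1 x = x;
  act_M : forall g h x, act (g * h) x = act g (act h x);
  act_mul : forall h x y,
    act h (x * y) = \sum_(p <- Delta h) act p.1 x * act p.2 y;
  act_unit : forall h, act h 1 = act (target_counit h) 1
}.

End ModuleAlgebra.

(* U = C_M(N), V = C_M1(M), A = C_M1(N), B = C_M2(M). *)
Notation algU iota := (centralizer (range iota)) (only parsing).
Notation algV j1 := (centralizer (range j1)) (only parsing).
Notation algA iota j1 := (centralizer (range (fun n => j1 (iota n)))) (only parsing).
Notation algB j1 j2 := (centralizer (range (fun m => j2 (j1 m)))) (only parsing).

Section Tower.
Variables (k : fieldType) (N M M1 M2 : algType k).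
Variables (iota : {lrmorphism N -> M}) (E : M -> N) (lam : k) (T : N -> k).
Variables (tens1 : {bilinear M -> M -> M1}) (j1 : {lrmorphism M -> M1}).
Variable EM : M1 -> M.
Variables (tens2 : {bilinear M1 -> M1 -> M2}) (j2 : {lrmorphism M1 -> M2}).
Variable EM1 : M2 -> M1.

Definition trace0 (m : M) : k := T (E m).
Definition trace1 (x : M1) : k := trace0 (EM x).
Definition trace2 (x : M2) : k := trace1 (EM1 x).

Let e1 : M1 := tens1 1 1.
Let e2 : M2 := tens2 1 1.

(* The second alternative is T_0 = T_1 o phi on U, where
   phi(u) = x_i u e_1 y_i = x_i u (x) y_i; the other half x_i y_i = lam^-1 of
   the first one is part of strong separability. *)
Definition symmetric_product (I : nat) (x y : 'I_I -> M) : Prop :=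
  \sum_i y i * x i = lam^-1 *: 1 \/
  forall u : algU iota,
    trace0 (val u) = trace1 (\sum_i tens1 (x i * val u) (y i)).

Definition weakly_irreducible : Prop :=
  kanzaki_separable (algU iota) /\
  nondegenerate_trace (fun u : algU iota => trace0 (val u)).

Definition depth_two : Prop :=
  (exists I (a a' : 'I_I -> algA iota j1),
     dual_bases j1 EM (fun i => val (a i)) (fun i => val (a' i))) /\
  (exists I (b b' : 'I_I -> algB j1 j2),
     dual_bases j2 EM1 (fun i => val (b i)) (fun i => val (b' i))).

(* w is the inverse of f_(1) T(f_(2)), T being the restriction of T_2. *)
Definition is_w (f : seq (algV j1 * algV j1)) (w : algV j1) : Prop :=
  let s := \sum_(p <- f) trace2 (j2 (val p.2)) *: p.1 in
  s * w = 1 /\ w * s = 1.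

(* <a, b> = lam^-2 T(a e_2 e_1 w b), computed in M_2. *)
Definition pairing (w : algV j1) (a : algA iota j1) (b : algB j1 j2) : k :=
  lam^-2 * trace2 (j2 (val a) * e2 * j2 e1 * j2 (val w) * val b).

(* <a, b>' = lam^-2 T(b e_1 e_2 w a). *)
Definition pairing' (w : algV j1) (a : algA iota j1) (b : algB j1 j2) : k :=
  lam^-2 * trace2 (val b * j2 e1 * e2 * j2 (val w) * j2 (val a)).

End Tower.

(* Main.v *)
Require Import Defs.
From HB Require Import structures.
From mathcomp Require Import all_boot all_order all_algebra.
From mathcomp Require Import boolp classical_sets.
Import GRing.Theory.
Local Open Scope ring_scope.

(** Why the theorem holds.  Write [e1 = 1 (x) 1] in M1, [tr = T E EM], and let
    x_i, y_i be the dual bases of E; repeated indices are summed, and the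
    inclusions of N, M, M1 are not written.  Every z in M1 acts on M by
    [z |> m = lam^-1 EM (z m e1)], that is, [z m e1 = (z |> m) e1]: this is M1
    acting by right N-linear endomorphisms of M.  It makes M a left module over
    M1, with values in M from the start.  What has to be shown is that, for
    a in A, the adjoint expression [a_(1) m S(a_(2))] is this element of M,
    that the action of A is compatible with the product of M, and that
    [h |> 1 = eps_t(h) |> 1].

    The first step eliminates M2.  The map [psi b = lam^-1 EM1 (e2 e1 w b)] (the
    definition [fourier]) carries B onto A, with an explicit section
    [inv_fourier], and [<a, b> = lam^-1 tr (a psi(b))]; it carries the product
    of B to the convolution [c, c' |-> ((c w^-1) |> x_i) c' y_i].  Hence the
    coproduct of A is determined inside M1 by
      [tr (a_(1) c) tr (a_(2) c') = lam tr (a ((c w^-1) |> x_i) c' y_i)]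
    for c, c' in A ([coproduct_tr]).

    The second step solves this for the coproduct.  The trace tr is
    nondegenerate on A and has explicit dual bases [al_i p] and [q al'_i], where
    al, al' in A are dual bases of EM and p, q, in U, correspond to the two legs
    of f (one of them multiplied by w) under the anti-isomorphism pi from V to U
    ([tunnel], [A_expand], [A_expand']).  Comparing traces gives
      [a_(1) tr (a_(2) c) = w^-1 X(c)],  [X(c) = x_i e1 EM (c y_i a)]
    ([sum_slice]).  Expanding the second leg in the dual bases, the sum over f
    collapses because [pi(w^-1 f_1) pi(f_2 w) = pi(f_2 f_1)] has sum 1
    ([sum_tunnel_dualU]); this is the reason for the w in the pairing.  One
    order of the dual bases yields the smash product relation
    [(a_(1) |> m) a_(2) = a m] ([smash_relation]), from which
    [a |> (m n) = (a_(1) |> m) (a_(2) |> n)] is immediate.  The other order yields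
    [a_(1) m S(a_(2)) = a |> m] ([adjoint_action]), once S is known.

    The third step computes S.  On A there is an anti-automorphism tau ([flip])
    exchanging the left action with the right action [e1 m z = e1 (m <| z)], and
    comparing the two pairings shows [S(a) = w^-1 tau(a) w] ([antipode_flip]).
    That tau is an involution with these properties rests on the left and
    right actions of A being adjoint for E ([lact_ract_adj]), which says that
    [E (EM (c z)) = E (EM (z c))] for c in A ([E_EM_comm]): the Nakayama
    automorphism of [E EM] on A is trivial, because tr is a nondegenerate
    trace there. *)

Set Implicit Arguments.
Unset Strict Implicit.
Unset Printing Implicit Defensive.

(** * Preliminaries on linear maps and centralizers *)

Lemma linear_as_hom (k : fieldType) (U V : lmodType k) (g : U -> V) :
  linear g -> exists h : {linear U -> V}, h =1 g.
Proof.
move=> lg; pose F := GRing.isLinear.Build k U V _ g lg.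
by exists (HB.pack g F : {linear U -> V}).
Qed.

Lemma bilinear_as_hom (k : fieldType) (U V W : lmodType k) (g : U -> V -> W) :
  (forall v, linear (g^~ v)) -> (forall u, linear (g u)) ->
  exists h : {bilinear U -> V -> W}, forall u v, h u v = g u v.
Proof.
move=> gl gr.
pose F := bilinear_isBilinear.Build k U V W *:%R *:%R g
  (conj (fun u v => gl u v) (fun u v => gr u v)).
by exists (HB.pack g F : {bilinear U -> V -> W}).
Qed.

Lemma centralizer_rangeP (k : fieldType) (X : algType k) (D : Type)
    (h : D -> X) (z : X) :
  z \in centralizer_pred (range h) <-> forall d, z * h d = h d * z.
Proof.
split=> [/centralizer_predP hz d | hz]; first by apply: hz; exists d.
by apply/centralizer_predP => _ [d _ <-].
Qed.

Lemma linear_sumE (k : fieldType) (X Y : lmodType k) (h : X -> Y) (J : Type)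
    (r : seq J) (F : J -> X) :
  linear h -> h (\sum_(i <- r) F i) = \sum_(i <- r) h (F i).
Proof.
move=> /linear_as_hom[h' hh]; rewrite -hh linear_sum.
by apply: eq_bigr => i _; rewrite hh.
Qed.

(** * The basic construction *)

Section BasicConstruction.
Variables (k : fieldType) (N M M1 : algType k) (iota : {lrmorphism N -> M}).
Variables (E : {linear M -> N}) (I : nat) (x y : 'I_I -> M) (lam : k).
Variables (tens : {bilinear M -> M -> M1}) (j : {lrmorphism M -> M1}).
Variable EM : {linear M1 -> M}.
Hypothesis bc : basic_construction iota E lam tens j EM.
Hypothesis Ebi : bimodule_map iota E.
Hypothesis db : dual_bases iota E x y.
Hypothesis lam0 : lam != 0.

Local Notation e1 := (tens 1 1).

Lemma tens_bal m n m' : tens (m * iota n) m' = tens m (iota n * m').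
Proof. by case: (bc_tensor bc) => H _; exact: H. Qed.

Lemma tens_mul m m' n n' :
  tens m m' * tens n n' = tens (m * iota (E (m' * n))) n'.
Proof. exact: (bc_mul bc). Qed.

Lemma EM_tens m m' : EM (tens m m') = lam *: (m * m').
Proof. exact: (bc_exp bc). Qed.

Lemma one_tens : 1 = \sum_i tens (x i) (y i).
Proof. exact: (bc_one bc). Qed.

Lemma j_tens m : j m = \sum_i tens (m * x i) (y i).
Proof. exact: (bc_incl bc). Qed.

Lemma E_l n m : E (iota n * m) = n * E m.
Proof. by have := Ebi n m 1; rewrite rmorph1 !mulr1. Qed.

Lemma E_r m n : E (m * iota n) = E m * n.
Proof. by have := Ebi 1 m n; rewrite rmorph1 !mul1r. Qed.

Lemma dual_bases_l m : \sum_i iota (E (m * x i)) * y i = m.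
Proof. by case: (db m). Qed.

Lemma dual_bases_r m : \sum_i x i * iota (E (y i * m)) = m.
Proof. by case: (db m). Qed.

Lemma j_tensl m a b : j m * tens a b = tens (m * a) b.
Proof.
rewrite j_tens mulr_suml -[in RHS](dual_bases_r a) mulr_sumr linear_sumlz.
by apply: eq_bigr => i _; rewrite tens_mul mulrA.
Qed.

Lemma j_tensr a b m : tens a b * j m = tens a (b * m).
Proof.
rewrite j_tens mulr_sumr -[in RHS](dual_bases_l (b * m)) linear_sumr.
by apply: eq_bigr => i _; rewrite tens_mul tens_bal mulrA.
Qed.

(** The actions are locked: unfolded, they have the shape [_ *: _], which
    rewriting rules for scaling would match everywhere. *)
Fact action_key : unit. Proof. by []. Qed.

Definition lact (z : M1) (m : M) : M :=
  locked_with action_key (lam^-1 *: EM (z * tens m 1)).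
Definition ract (z : M1) (m : M) : M :=
  locked_with action_key (lam^-1 *: EM (tens 1 m * z)).

Lemma lactE z m : lact z m = lam^-1 *: EM (z * tens m 1).
Proof. by rewrite /lact unlock. Qed.

Lemma ractE z m : ract z m = lam^-1 *: EM (tens 1 m * z).
Proof. by rewrite /ract unlock. Qed.

Lemma lact_is_linear_l m : linear (lact^~ m).
Proof.
by move=> a u v; rewrite !lactE mulrDl linearD -scalerAl linearZ scalerDr
  !scalerA mulrC.
Qed.

Lemma lact_is_linear_r z : linear (lact z).
Proof.
by move=> a u v; rewrite !lactE linearPl mulrDr linearD -scalerAr linearZ
  scalerDr !scalerA mulrC.
Qed.
HB.instance Definition _ :=
  bilinear_isBilinear.Build k M1 M M *:%R *:%R lact
    (conj lact_is_linear_l lact_is_linear_r).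

Lemma ract_is_linear_l m : linear (ract^~ m).
Proof.
by move=> a u v; rewrite !ractE mulrDr linearD -scalerAr linearZ scalerDr
  !scalerA mulrC.
Qed.

Lemma ract_is_linear_r z : linear (ract z).
Proof.
by move=> a u v; rewrite !ractE linearPr mulrDl linearD -scalerAl linearZ
  scalerDr !scalerA mulrC.
Qed.
HB.instance Definition _ :=
  bilinear_isBilinear.Build k M1 M M *:%R *:%R ract
    (conj ract_is_linear_l ract_is_linear_r).

Lemma scale_lamKV (V : lmodType k) (v : V) : lam *: (lam^-1 *: v) = v.
Proof. by rewrite scalerA divff ?scale1r. Qed.
Lemma scale_lamK (V : lmodType k) (v : V) : lam^-1 *: (lam *: v) = v.
Proof. by rewrite scalerA mulVf ?scale1r. Qed.

Lemma lact_tens a b m : lact (tens a b) m = a * iota (E (b * m)).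
Proof. by rewrite lactE tens_mul EM_tens mulr1 scale_lamK. Qed.

Lemma ract_tens a b m : ract (tens a b) m = iota (E (m * a)) * b.
Proof. by rewrite ractE tens_mul EM_tens mul1r scale_lamK. Qed.

(** The uniqueness half of the universal property, used with values in M1
    itself: M1 is spanned by tensors. *)
Lemma tens_ext (h1 h2 : {linear M1 -> M1}) :
  (forall m m', h1 (tens m m') = h2 (tens m m')) -> h1 =1 h2.
Proof.
move=> h12.
have [b Hb] : exists b : {bilinear M -> M -> M1},
    forall u v, b u v = h2 (tens u v).
  apply: (@bilinear_as_hom _ _ _ _ (fun u v => h2 (tens u v))) => u a v v' /=.
    by rewrite linearPl linearP.
  by rewrite linearPr linearP.
have [_ /(_ M1 b)[]] := bc_tensor bc.
  by move=> m n m'; rewrite !Hb tens_bal.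
by move=> _; apply => m m'; rewrite Hb.
Qed.

(** Both sides are linear in z, and on tensors the identity is the dual basis
    property of x, y.  It turns the universal property into a normal form for
    elements of M1, and shows that z is determined by its action on M. *)
Lemma expand_l z : z = \sum_i tens (lact z (x i)) (y i).
Proof.
have [h Hh] : exists h : {linear M1 -> M1},
    h =1 (fun z => \sum_i tens (lact z (x i)) (y i)).
  apply: linear_as_hom => a u v; rewrite scaler_sumr -big_split.
  by apply: eq_bigr => i _ /=; rewrite !linearPl.
rewrite -Hh; apply: (@tens_ext idfun h) => m m' /=.
rewrite Hh -{1}(dual_bases_l m') linear_sumr; apply: eq_bigr => i _.
by rewrite lact_tens tens_bal.
Qed.

Lemma expand_r z : z = \sum_i tens (x i) (ract z (y i)).
Proof.
have [h Hh] : exists h : {linear M1 -> M1},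
    h =1 (fun z => \sum_i tens (x i) (ract z (y i))).
  apply: linear_as_hom => a u v; rewrite scaler_sumr -big_split.
  by apply: eq_bigr => i _ /=; rewrite linearPl linearPr.
rewrite -Hh; apply: (@tens_ext idfun h) => m m' /=.
rewrite Hh -{1}(dual_bases_r m) linear_sumlz; apply: eq_bigr => i _.
by rewrite ract_tens tens_bal.
Qed.

Lemma e1_iota n : e1 * j (iota n) = j (iota n) * e1.
Proof.
by rewrite j_tensl j_tensr mul1r mulr1 -[in RHS](mul1r (iota n)) tens_bal mulr1.
Qed.

Lemma EM_bimod : bimodule_map j EM.
Proof.
move=> a z b; rewrite (expand_l z) mulr_sumr mulr_suml !linear_sum mulr_sumr mulr_suml.
apply: eq_bigr => i _.
by rewrite j_tensl j_tensr !EM_tens -[in RHS]scalerAr -[RHS]scalerAl !mulrA.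
Qed.

Lemma EM_l m z : EM (j m * z) = m * EM z.
Proof. by have := EM_bimod m z 1; rewrite rmorph1 !mulr1. Qed.

Lemma EM_r z m : EM (z * j m) = EM z * m.
Proof. by have := EM_bimod 1 z m; rewrite rmorph1 !mul1r. Qed.

(** With [m' = 1] this is the relation [z m e1 = (z |> m) e1]. *)
Lemma mul_tens_l z m m' : z * tens m m' = tens (lact z m) m'.
Proof.
rewrite {1}(expand_l z) mulr_suml [in RHS](expand_l z) !linear_sumlz.
by apply: eq_bigr => i _; rewrite tens_mul /= lact_tens.
Qed.

Lemma mul_tens_r z m m' : tens m m' * z = tens m (ract z m').
Proof.
rewrite {1}(expand_r z) mulr_sumr [in RHS](expand_r z) linear_sumlz linear_sumr.
by apply: eq_bigr => i _; rewrite tens_mul /= ract_tens tens_bal.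
Qed.

Lemma lactM z z' m : lact (z * z') m = lact z (lact z' m).
Proof. by rewrite {1}lactE -mulrA !mul_tens_l EM_tens mulr1 scale_lamK. Qed.

Lemma ractM z z' m : ract (z * z') m = ract z' (ract z m).
Proof. by rewrite {1}ractE mulrA !mul_tens_r EM_tens mul1r scale_lamK. Qed.

Lemma lact_inj z z' : lact z =1 lact z' -> z = z'.
Proof.
move=> h; rewrite (expand_l z) (expand_l z').
by apply: eq_bigr => i _; rewrite h.
Qed.

Lemma ract_inj z z' : ract z =1 ract z' -> z = z'.
Proof.
move=> h; rewrite (expand_r z) (expand_r z').
by apply: eq_bigr => i _; rewrite h.
Qed.

Lemma lact_j n m : lact (j n) m = n * m.
Proof. by rewrite lactE j_tensl EM_tens mulr1 scale_lamK. Qed.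

Lemma ract_j n m : ract (j n) m = m * n.
Proof. by rewrite ractE j_tensr EM_tens mul1r scale_lamK. Qed.

Lemma lact_iota z m n : lact z (m * iota n) = lact z m * iota n.
Proof.
by rewrite !lactE tens_bal mulr1 -[iota n]mul1r -j_tensr mulrA EM_r mul1r scalerAl.
Qed.

Lemma ract_iota z m n : ract z (iota n * m) = iota n * ract z m.
Proof.
by rewrite !ractE -tens_bal mul1r -[iota n]mulr1 -j_tensl -mulrA EM_l mulr1 scalerAr.
Qed.

Let X i := lam^-1 *: tens (x i) 1.
Let Y i := tens 1 (y i).

Lemma EM_dual_bases : dual_bases j EM X Y.
Proof.
move=> z; split.
  rewrite [RHS](expand_l z); apply: eq_bigr => i _.
  by rewrite j_tensl mulr1 lactE /X -scalerAr linearZ.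
rewrite [RHS](expand_r z); apply: eq_bigr => i _.
by rewrite /X -scalerAl j_tensr mul1r ractE linearZr_LR.
Qed.

Hypothesis E1 : E 1 = 1.
Hypothesis index : \sum_i x i * y i = lam^-1 *: 1.

Lemma EM_dual_index : \sum_i X i * Y i = lam^-1 *: 1.
Proof.
rewrite one_tens scaler_sumr; apply: eq_bigr => i _.
by rewrite /X /Y -scalerAl tens_mul mulr1 E1 rmorph1 mulr1.
Qed.

(** This is where the index of the extension enters; together with
    [EM_dual_index] it lets the argument be repeated one level up. *)
Lemma EM_one : EM 1 = 1.
Proof.
rewrite one_tens linear_sum -[RHS](scale_lamKV 1) -index scaler_sumr.
by apply: eq_bigr => i _; rewrite EM_tens.
Qed.

(** The sum of [x i (x) y i] is a Casimir element of [M (x)_N M]; this passes to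
    an algebra R under M as soon as z makes [h x_i * z * h y_i] N-balanced. *)
Lemma casimir_comm (R : algType k) (h : {lrmorphism M -> R}) (z : R) :
  (forall n, z * h (iota n) = h (iota n) * z) ->
  forall m, h m * (\sum_i h (x i) * z * h (y i)) = (\sum_i h (x i) * z * h (y i)) * h m.
Proof.
move=> hz m; rewrite mulr_sumr mulr_suml.
transitivity (\sum_i \sum_l h (x l) * h (iota (E (y l * (m * x i)))) * z * h (y i)).
  apply: eq_bigr => i _; rewrite !mulrA -rmorphM -[in LHS](dual_bases_r (m * x i)).
  by rewrite rmorph_sum !mulr_suml; apply: eq_bigr => l _; rewrite rmorphM.
rewrite exchange_big; apply: eq_bigr => l _ /=.
rewrite -[RHS]mulrA -rmorphM -[in RHS](dual_bases_l (y l * m)) rmorph_sum mulr_sumr.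
by apply: eq_bigr => i _; rewrite rmorphM [RHS]mulrA -(mulrA _ z (h (iota _))) hz !mulrA.
Qed.

Section Trace.
Variable T : {scalar N}.
Hypothesis hT : is_trace T.
Hypothesis hTE : is_trace (fun m => T (E m)).

(** On the product of [a (x) b] and [c (x) d] this functional takes the value
    [lam * T (E (d a) E (b c))], which is symmetric in the two tensors. *)
Lemma trace_EM : is_trace (fun z => T (E (EM z))).
Proof.
move=> z z'; rewrite (expand_l z) (expand_l z') !mulr_suml !linear_sum.
under eq_bigr => i _ do rewrite mulr_sumr !linear_sum.
under [RHS]eq_bigr => i _ do rewrite mulr_sumr !linear_sum.
rewrite [RHS]exchange_big; apply: eq_bigr => i _; apply: eq_bigr => l _ /=.
have tr a b c d : T (E (EM (tens a b * tens c d))) = lam * T (E (d * a) * E (b * c)).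
  rewrite tens_mul EM_tens !linearZ /= -mulrA; congr (_ * _).
  by rewrite [LHS]hTE -mulrA E_l; apply: hT.
by rewrite !tr; congr (_ * _); apply: hT.
Qed.

End Trace.

(** * The centralizers U, V, A and their actions on M *)

Definition left_linear (h : M -> M) := forall n m, h (iota n * m) = iota n * h m.
Definition right_linear (h : M -> M) := forall m n, h (m * iota n) = h m * iota n.

(** The elements of M1 with a prescribed right (left) action h: every left
    (right) N-linear endomorphism of M is the action of an element of M1. *)
Definition of_ract (h : M -> M) : M1 := \sum_i tens (x i) (h (y i)).
Definition of_lact (h : M -> M) : M1 := \sum_i tens (h (x i)) (y i).

Lemma ract_of_ract h m : linear h -> left_linear h -> ract (of_ract h) m = h m.
Proof.
move=> hl hN; rewrite /of_ract linear_sumlz -[in RHS](dual_bases_l m) linear_sumE //.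
by apply: eq_bigr => i _; rewrite /= ract_tens hN.
Qed.

Lemma lact_of_lact h m : linear h -> right_linear h -> lact (of_lact h) m = h m.
Proof.
move=> hl hN; rewrite /of_lact linear_sumlz -[in RHS](dual_bases_r m) linear_sumE //.
by apply: eq_bigr => i _; rewrite /= lact_tens hN.
Qed.

Lemma lact_of_ract h m :
  lact (of_ract h) m = \sum_i x i * iota (E (h (y i) * m)).
Proof.
rewrite /of_ract linear_sumlz.
by apply: eq_bigr => i _; rewrite /= lact_tens.
Qed.

Lemma ract_of_lact h m :
  ract (of_lact h) m = \sum_i iota (E (m * h (x i))) * y i.
Proof.
rewrite /of_lact linear_sumlz.
by apply: eq_bigr => i _; rewrite /= ract_tens.
Qed.

(** Again the Casimir property; left linearity of h is what makes
    [m * h m'] balanced over N. *)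
Lemma casimir_left_linear (h : M -> M) m : linear h -> left_linear h ->
  \sum_i m * x i * h (y i) = \sum_i x i * h (y i * m).
Proof.
move=> hl hN.
transitivity (\sum_i \sum_l x l * iota (E (y l * (m * x i))) * h (y i)).
  apply: eq_bigr => i _; rewrite -[in LHS](dual_bases_r (m * x i)).
  by rewrite mulr_suml.
rewrite exchange_big; apply: eq_bigr => l _ /=.
rewrite -[in RHS](dual_bases_l (y l * m)) linear_sumE // mulr_sumr.
by apply: eq_bigr => i _; rewrite hN !mulrA.
Qed.

Local Notation Ucent := (centralizer_pred (range iota)).
Local Notation Vcent := (centralizer_pred (range j)).
Local Notation Acent := (centralizer_pred (range (fun n => j (iota n)))).

Lemma V_sub_A v : v \in Vcent -> v \in Acent.
Proof. by move=> /centralizer_rangeP hv; apply/centralizer_rangeP => n; apply: hv. Qed.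

Lemma U_sub_A u : u \in Ucent -> j u \in Acent.
Proof.
move=> /centralizer_rangeP hu; apply/centralizer_rangeP => n.
by rewrite -!rmorphM hu.
Qed.

Lemma lact_A c : c \in Acent <-> left_linear (lact c).
Proof.
split=> [/centralizer_rangeP hc n m | hc].
  by rewrite -!lact_j -!lactM hc.
by apply/centralizer_rangeP => n; apply: lact_inj => m; rewrite !lactM !lact_j hc.
Qed.

Lemma ract_A c : c \in Acent <-> right_linear (ract c).
Proof.
split=> [/centralizer_rangeP hc m n | hc].
  by rewrite -!ract_j -!ractM hc.
by apply/centralizer_rangeP => n; apply: ract_inj => m; rewrite !ractM !ract_j hc.
Qed.

Lemma EM_A c : c \in Acent -> EM c \in Ucent.
Proof.
move=> /centralizer_rangeP hc; apply/centralizer_rangeP => n.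
by rewrite -EM_r hc EM_l.
Qed.

(** The anti-isomorphism between V and U, in the direction V to U: an element
    of V acts on M by right multiplication by an element of U.  Its inverse
    [untunnel] is [u |-> x_i u e1 y_i]. *)
Definition tunnel (v : M1) : M := lact v 1.

Lemma lact_V v m : v \in Vcent -> lact v m = m * tunnel v.
Proof.
move=> /centralizer_rangeP hv.
by rewrite -[m in LHS]mulr1 -[m * 1]lact_j -lactM hv lactM lact_j.
Qed.

Lemma tunnel_U v : v \in Vcent -> tunnel v \in Ucent.
Proof.
move=> hv; apply/centralizer_rangeP => n.
by rewrite -lact_iota mul1r lact_V.
Qed.

Lemma tunnelM v v' : v \in Vcent -> tunnel (v * v') = tunnel v' * tunnel v.
Proof. by move=> hv; rewrite /tunnel lactM [LHS]lact_V. Qed.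

Lemma tunnel1 : tunnel 1 = 1.
Proof. by rewrite /tunnel -(rmorph1 j) lact_j mulr1. Qed.

Lemma lact_U c : c \in Acent -> lact c 1 \in Ucent.
Proof.
move=> /lact_A hc; apply/centralizer_rangeP => n.
by rewrite -lact_iota -[in RHS]hc mulr1 mul1r.
Qed.

Definition untunnel (u : M) : M1 := of_lact (fun m => m * u).

Lemma lact_untunnel u m : u \in Ucent -> lact (untunnel u) m = m * u.
Proof.
move=> /centralizer_rangeP hu; rewrite lact_of_lact //.
  by move=> a b c; rewrite mulrDl scalerAl.
by move=> b n; rewrite -!mulrA hu.
Qed.

Lemma untunnel_V u : u \in Ucent -> untunnel u \in Vcent.
Proof.
move=> hu; apply/centralizer_rangeP => n; apply: lact_inj => m.
by rewrite !lactM !lact_j !lact_untunnel // mulrA.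
Qed.

Lemma untunnelK u : u \in Ucent -> tunnel (untunnel u) = u.
Proof. by move=> hu; rewrite /tunnel lact_untunnel // mul1r. Qed.

Lemma tunnelK v : v \in Vcent -> untunnel (tunnel v) = v.
Proof.
move=> hv; rewrite [RHS]expand_l; apply: eq_bigr => i _.
by rewrite lact_V.
Qed.

(** * Nondegeneracy of the trace on A *)

Section Markov.
Variable T : {scalar N}.
Hypothesis hT : is_trace T.
Hypothesis hTE : is_trace (fun m => T (E m)).
Hypothesis hUE : forall u, u \in Ucent -> forall m, E (u * m) = E (m * u).
Hypothesis hphi : forall u, u \in Ucent -> T (E u) = T (E (EM (untunnel u))).

Definition tr (z : M1) : k := T (E (EM z)).

Lemma trC z z' : tr (z * z') = tr (z' * z).
Proof. exact: (trace_EM hT hTE). Qed.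
Lemma tr_linear : linear (tr : M1 -> k^o).
Proof. by move=> a u v; rewrite /tr !linearP. Qed.
HB.instance Definition _ := GRing.isLinear.Build k M1 k^o _ tr tr_linear.

Lemma trZ a z : tr (a *: z) = a * tr z.
Proof. by rewrite linearZ. Qed.

Lemma tr_tens a b : tr (tens a b) = lam * T (E (a * b)).
Proof. by rewrite /tr EM_tens !linearZ. Qed.

Lemma tr_tunnel v : v \in Vcent -> tr v = T (E (tunnel v)).
Proof. by move=> hv; rewrite [RHS]hphi ?tunnel_U // tunnelK. Qed.

(** The only use of [E (u m) = E (m u)]: the element of U attached to v for
    the left action is also the one for the right action. *)
Lemma ract_V v m : v \in Vcent -> ract v m = tunnel v * m.
Proof.
move=> hV; have /centralizer_rangeP hv := hV.
rewrite -[m in LHS]mul1r -[1 * m]ract_j -ractM -hv ractM ract_j; congr (_ * _).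
rewrite -{1}(tunnelK hV) ract_of_lact -[RHS]dual_bases_l; apply: eq_bigr => i _.
by rewrite mul1r (hUE (tunnel_U hV)).
Qed.

Lemma mul_tens_V a b v : v \in Vcent -> tens a b * v = tens a (tunnel v * b).
Proof. by move=> hv; rewrite mul_tens_r ract_V. Qed.

Local Notation V := (centralizer (range j)).
Variables (f : seq (V * V)) (s w : V).
Hypothesis hf : symmetric_separability_element f.
Hypothesis hs : s = \sum_(p <- f) tr (val p.2) *: p.1.
Hypothesis sw : s * w = 1.
Hypothesis ws : w * s = 1.

(** The two legs of f are tested against the bilinear map
    [(a, c) |-> tr a *: c]; the comparison with [casimir_trace_r] makes s,
    hence w, central. *)
Lemma casimir_trace_l v :
  \sum_(p <- f) tr (val (v * p.1)) *: p.2 = s * v.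
Proof.
case: hf => _ hf2 hf3.
have [b hb] : exists b : {bilinear V -> V -> V},
    forall a c, b a c = tr (val a) *: c.
  apply: bilinear_as_hom => [c a u u' | u a c c'] /=.
    by rewrite linearP scalerDl scalerA.
  by rewrite scalerDr !scalerA mulrC.
have := hf2 v _ b; rewrite !big_map /= => q1.
have := hf3 _ b; rewrite !big_map /= => q2.
transitivity (\sum_(p <- f) b p.1 (p.2 * v)).
  by rewrite -q1; apply: eq_bigr => p _; rewrite hb.
rewrite hs; transitivity ((\sum_(p <- f) b p.1 p.2) * v).
  by rewrite mulr_suml; apply: eq_bigr => p _; rewrite !hb scalerAl.
by rewrite q2; congr (_ * _); apply: eq_bigr => p _; rewrite hb.
Qed.

Lemma casimir_trace_r v :
  \sum_(p <- f) tr (val (p.1 * v)) *: p.2 = v * s.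
Proof.
case: hf => _ hf2 hf3.
have [b hb] : exists b : {bilinear V -> V -> V},
    forall a c, b a c = tr (val (a * v)) *: c.
  apply: bilinear_as_hom => [c a u u' | u a c c'] /=.
    by rewrite mulrDl -scalerAl linearP scalerDl scalerA.
  by rewrite scalerDr !scalerA mulrC.
have [b' hb'] : exists b : {bilinear V -> V -> V},
    forall a c, b a c = tr (val c) *: a.
  apply: bilinear_as_hom => [c a u u' | u a c c'] /=.
    by rewrite scalerDr !scalerA mulrC.
  by rewrite linearP scalerDl scalerA.
have := hf2 v _ b'; rewrite !big_map /= => q1.
have := hf3 _ b; rewrite !big_map /= => q2.
transitivity (\sum_(p <- f) b p.1 p.2).
  by apply: eq_bigr => p _; rewrite hb.
rewrite q2; transitivity (\sum_(p <- f) b' p.1 (p.2 * v)).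
  by apply: eq_bigr => p _; rewrite hb hb'.
rewrite -q1 hs mulr_sumr; apply: eq_bigr => p _.
by rewrite hb' scalerAr.
Qed.

Lemma s_central v : s * v = v * s.
Proof.
rewrite -casimir_trace_l -casimir_trace_r.
by apply: eq_bigr => p _; rewrite /= trC.
Qed.

Lemma w_central v : w * v = v * w.
Proof. by rewrite -[v in LHS]mulr1 -sw [v * _]mulrA -s_central !mulrA ws mul1r. Qed.

(** So f, with its second leg multiplied by w, is a pair of dual bases for the
    trace on V. *)
Lemma V_expand v :
  v = \sum_(p <- f) tr (val (v * p.1)) *: (p.2 * w).
Proof.
transitivity ((s * v) * w); first by rewrite -mulrA -w_central mulrA sw mul1r.
rewrite -casimir_trace_l mulr_suml; apply: eq_bigr => p _.
by rewrite scalerAl.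
Qed.

Lemma casimir_flip : \sum_(p <- f) p.2 * p.1 = 1.
Proof.
case: hf => hf1 _ hf3.
have [b hb] : exists b : {bilinear V -> V -> V}, forall a c, b a c = a * c.
  apply: bilinear_as_hom => [c a u u' | u a c c'] /=.
    by rewrite mulrDl scalerAl.
  by rewrite mulrDr scalerAr.
have := hf3 _ b; rewrite !big_map /= => q2.
rewrite -hf1; transitivity (\sum_(p <- f) b p.2 p.1).
  by apply: eq_bigr => p _; rewrite hb.
by rewrite -q2; apply: eq_bigr => p _; rewrite hb.
Qed.

(** The dual bases of [V_expand] carried to U; since T E on U corresponds to tr
    on V, they are dual bases for T E ([U_expand]). *)
Definition dualU (p : V * V) : M := tunnel (val p.1).
Definition dualU' (p : V * V) : M := tunnel (val (p.2 * w)).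

Lemma val_V (v : V) : val v \in Vcent.
Proof. exact: valP. Qed.

Lemma U_expand u : u \in Ucent ->
  u = \sum_(p <- f) T (E (u * dualU p)) *: dualU' p.
Proof.
move=> hu; rewrite -{1}(untunnelK hu).
have hv := untunnel_V hu; pose v : V := Centralizer hv.
rewrite -[untunnel u]/(val v) {1}(V_expand v) linear_sum /tunnel linear_sumlz.
apply: eq_bigr => p _.
rewrite /= linearZl_LR /=; congr (_ *: _).
rewrite tr_tunnel; last by rewrite rpredM ?val_V.
rewrite tunnelM ?val_V //= (untunnelK hu).
exact: hTE.
Qed.

(** The reason for twisting by w: the inverse s of w cancels the w in
    [dualU'], and the order reversal of [tunnel] leaves [p.2 * p.1], whose sum
    is 1 by symmetry of f. *)
Lemma sum_tunnel_dualU : \sum_(p <- f) tunnel (val (s * p.1)) * dualU' p = 1.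
Proof.
rewrite -tunnel1 -(rmorph1 (val : V -> M1)) -casimir_flip rmorph_sum /tunnel linear_sumlz.
apply: eq_bigr => p _.
by rewrite /dualU' -tunnelM ?val_V // -rmorphM -mulrA [w * _]mulrA ws mul1r.
Qed.

Variables (J : nat) (al al' : 'I_J -> M1).
Hypothesis al_A : forall i, al i \in Acent.
Hypothesis al'_A : forall i, al' i \in Acent.
Hypothesis dbA : dual_bases j EM al al'.

Lemma jZ a m : j (a *: m) = a *: j m.
Proof. exact: linearZ. Qed.

Lemma tr_j z m : tr (z * j m) = T (E (EM z * m)).
Proof. by rewrite /tr EM_r. Qed.

Lemma dualU_U p : dualU p \in Ucent.
Proof. by rewrite tunnel_U ?val_V. Qed.
Lemma dualU'_U p : dualU' p \in Ucent.
Proof. by rewrite tunnel_U ?val_V. Qed.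

(** First expand c over M along the dual bases of EM lying in A, then expand
    the coefficients, which lie in U. *)
Lemma A_expand c : c \in Acent ->
  c = \sum_i \sum_(p <- f) tr (c * (al i * j (dualU p))) *: (j (dualU' p) * al' i).
Proof.
move=> hc; rewrite -[LHS](dbA c).1; apply: eq_bigr => i _.
have hu : EM (c * al i) \in Ucent by rewrite EM_A ?rpredM.
rewrite {1}(U_expand hu) rmorph_sum mulr_suml; apply: eq_bigr => p _.
by rewrite /= (jZ _ (dualU' p)) -[LHS]scalerAl mulrA tr_j.
Qed.

Lemma tr_nondeg c d : c \in Acent -> d \in Acent ->
  (forall z, z \in Acent -> tr (c * z) = tr (d * z)) -> c = d.
Proof.
move=> hc hd h; rewrite (A_expand hc) (A_expand hd).
apply: eq_bigr => i _; apply: eq_bigr => p _.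
by rewrite h // rpredM // U_sub_A // dualU_U.
Qed.

(** The same dual bases in the other order; tr being a trace, they may be
    exchanged. *)
Lemma A_expand' c : c \in Acent ->
  c = \sum_i \sum_(p <- f) tr (c * (j (dualU' p) * al' i)) *: (al i * j (dualU p)).
Proof.
move=> hc; apply: tr_nondeg => // [|z hz].
  apply: rpred_sum => i _; apply: rpred_sum => p _; apply: rpredZ.
  by rewrite rpredM // U_sub_A // dualU_U.
rewrite {1}(A_expand hz) mulr_sumr mulr_suml !linear_sum; apply: eq_bigr => i _.
rewrite mulr_sumr mulr_suml !linear_sum; apply: eq_bigr => p _.
by rewrite /= -scalerAr -scalerAl !trZ mulrC [tr (z * _)]trC.
Qed.

(** The functional [E EM] has a Nakayama automorphism on A: there is d in A
    with [E EM (c z) = E EM (z d)] for all z, and d is written down through its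
    right action R on M.  Composing with T gives [tr (z c) = tr (z d)], so
    [d = c] by nondegeneracy on A.  This detour is needed as T itself may be
    degenerate on N. *)
Lemma E_EM_comm c z : c \in Acent -> E (EM (c * z)) = E (EM (z * c)).
Proof.
move=> hc; have lc := (lact_A c).1 hc.
pose R m := \sum_i x i * iota (E (lact c (y i) * m)).
have R_lin : linear R.
  move=> a u v; rewrite /R scaler_sumr -big_split; apply: eq_bigr => i _ /=.
  by rewrite mulrDr !linearD /= -scalerAr !linearZ /= mulrDr scalerAr.
have R_l : left_linear R.
  move=> n m; rewrite /R mulr_sumr.
  have h1 : linear (fun y => iota (E (lact c y * m))).
    by move=> a u v; rewrite linearPr mulrDl !linearD -scalerAl !linearZ.
  have h2 : left_linear (fun y => iota (E (lact c y * m))).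
    by move=> n' m'; rewrite lc -mulrA E_l rmorphM.
  have := casimir_left_linear (iota n) h1 h2.
  under eq_bigr => i _ do rewrite -mulrA.
  by move=> ->; apply: eq_bigr => i _; rewrite lact_iota -mulrA.
have R_r : right_linear R.
  move=> m n; rewrite /R mulr_suml; apply: eq_bigr => i _.
  by rewrite mulrA E_r rmorphM mulrA.
pose d := of_ract R.
have dE m : ract d m = R m by rewrite ract_of_ract.
have hd : d \in Acent by apply/ract_A => m n; rewrite !dE.
have key z' : E (EM (c * z')) = E (EM (z' * d)).
  rewrite (expand_l z') mulr_sumr mulr_suml !linear_sum; apply: eq_bigr => i _.
  rewrite mul_tens_l mul_tens_r !EM_tens !linearZ /= dE; congr (_ *: _).
  set m := lact z' _; rewrite -{1}(dual_bases_l m) linear_sumr mulr_suml linear_sum.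
  rewrite /R mulr_sumr linear_sum.
  by apply: eq_bigr => l _; rewrite /= lc -mulrA E_l mulrA E_r.
rewrite key; congr (E (EM (_ * _))); apply: tr_nondeg => // z' _.
by rewrite trC /tr -key -/(tr _) trC.
Qed.

(** [E_EM_comm] on a tensor [m (x) m']. *)
Lemma lact_ract_adj c m m' : c \in Acent ->
  E (lact c m * m') = E (m * ract c m').
Proof.
move=> hc; have := E_EM_comm (tens m m') hc.
rewrite mul_tens_l mul_tens_r !EM_tens !linearZ /=.
by move/(congr1 ( *:%R lam^-1)); rewrite !scale_lamK.
Qed.

(** * The anti-automorphism exchanging the two actions of A *)

Definition flip (c : M1) : M1 := of_lact (ract c).

Lemma lact_flip c m : c \in Acent -> lact (flip c) m = ract c m.
Proof.
move=> hc; rewrite lact_of_lact //; first exact: ract_is_linear_r.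
exact/ract_A.
Qed.

Lemma ract_flip c m : c \in Acent -> ract (flip c) m = lact c m.
Proof.
move=> hc; rewrite ract_of_lact -[RHS]dual_bases_l; apply: eq_bigr => i _.
by rewrite lact_ract_adj.
Qed.

Lemma flip_A c : c \in Acent -> flip c \in Acent.
Proof.
move=> hc; apply/ract_A => m n.
by rewrite !ract_flip // lact_iota.
Qed.

Lemma flipK c : c \in Acent -> flip (flip c) = c.
Proof. by move=> hc; apply: lact_inj => m; rewrite lact_flip ?flip_A // ract_flip. Qed.

Lemma flipM c d : c \in Acent -> d \in Acent -> flip (c * d) = flip d * flip c.
Proof.
move=> hc hd; apply: lact_inj => m.
by rewrite lact_flip ?rpredM // lactM !lact_flip // ractM.
Qed.

Lemma flip_V v : v \in Vcent -> flip v = j (tunnel v).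
Proof.
move=> hv; apply: lact_inj => m.
by rewrite lact_flip ?V_sub_A // ract_V // lact_j.
Qed.

Lemma flip_tunnel v : v \in Vcent -> flip (j (tunnel v)) = v.
Proof. by move=> hv; rewrite -flip_V // flipK // V_sub_A. Qed.

Lemma flip_linear : linear flip.
Proof.
move=> a u v; rewrite /flip /of_lact scaler_sumr -big_split.
by apply: eq_bigr => i _ /=; rewrite !linearPl.
Qed.

(** Put [v = x_i c y_i], an element of V.  The trace of [flip c] is that of
    [e1 * v], hence [lam] times that of v.  So is the trace of
    [untunnel (EM c)], which by hypothesis is [T (E (EM c)) = tr c]. *)
Lemma tr_flip c : c \in Acent -> tr (flip c) = tr c.
Proof.
move=> hc; pose v := \sum_i j (x i) * c * j (y i).
have hv : v \in Vcent.
  apply/centralizer_rangeP => m; rewrite /v casimir_comm //.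
  by move/centralizer_rangeP: hc.
have -> : tr (flip c) = tr (e1 * v).
  rewrite /flip /of_lact /v mulr_sumr !linear_sum; apply: eq_bigr => i _ /=.
  rewrite tr_tens !mulrA j_tensr mul1r mul_tens_r j_tensr.
  by rewrite tr_tens mul1r.
rewrite trC -[v]mulr1 -mulrA mul1r mul_tens_l lact_V // mul1r tr_tens mulr1 -tr_tunnel //.
have -> : tr v = T (E (\sum_i x i * EM c * y i)).
  rewrite /v /tr !linear_sum; apply: eq_bigr => i _ /=.
  by rewrite EM_r EM_l.
have hu := EM_A hc.
rewrite [RHS](hphi hu) /untunnel /of_lact !linear_sum mulr_sumr.
by apply: eq_bigr => i _ /=; rewrite EM_tens !linearZ.
Qed.

(** * The coproduct of A and its slices *)

(** The sum of [r.1 (x) r.2] over D is the coproduct of a, expressed by the trace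
    of M1 alone: the right-hand side is the trace of a against the convolution
    of c and c', the product of B transported to A. *)
Definition is_coproduct (a : M1) (D : seq (M1 * M1)) :=
  (forall r, r \in D -> r.1 \in Acent /\ r.2 \in Acent) /\
  forall c c', c \in Acent -> c' \in Acent ->
    \sum_(r <- D) tr (r.1 * c) * tr (r.2 * c') =
    lam * \sum_i tr (a * j (lact (c * val s) (x i)) * c' * j (y i)).

Section Coproduct.
Variables (a : M1) (D : seq (M1 * M1)).
Hypothesis aA : a \in Acent.
Hypothesis hD : is_coproduct a D.

(** The element [x_i e1 EM (c y_i a)], characterised by its right action
    [m |-> EM (c m a)]. *)
Definition slice (c : M1) : M1 := of_ract (fun m => EM (c * j m * a)).

Lemma slice_fun_linear c : linear (fun m => EM (c * j m * a)).
Proof.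
move=> b u v.
by rewrite linearP mulrDr mulrDl linearD -scalerAr -scalerAl linearZ.
Qed.

Lemma slice_fun_l c : c \in Acent -> left_linear (fun m => EM (c * j m * a)).
Proof.
move=> /centralizer_rangeP hc n m.
by rewrite rmorphM !mulrA hc -!mulrA EM_l.
Qed.

Lemma ract_slice c m : c \in Acent -> ract (slice c) m = EM (c * j m * a).
Proof.
move=> hc; rewrite ract_of_ract //; first exact: slice_fun_linear.
exact: slice_fun_l.
Qed.

Lemma slice_A c : c \in Acent -> slice c \in Acent.
Proof.
move=> hc; apply/ract_A => m n; rewrite !ract_slice // rmorphM.
by move/centralizer_rangeP: aA => ha; rewrite -!mulrA -ha !mulrA EM_r.
Qed.

(** Both sides lie in A, so it is enough to compare their traces against z
    in A, and there it is the defining property of the coproduct. *)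
Lemma sum_slice c : c \in Acent ->
  \sum_(r <- D) tr (r.2 * c) *: r.1 = val s * slice c.
Proof.
move=> hc; case: hD => DA De; apply: tr_nondeg => [||z hz].
- rewrite big_seq; apply: rpred_sum => r hr; apply: rpredZ.
  by case: (DA r hr).
- by rewrite rpredM ?slice_A // V_sub_A ?val_V.
rewrite [RHS]trC mulr_suml linear_sum /=.
transitivity (\sum_(r <- D) tr (r.1 * z) * tr (r.2 * c)).
  by apply: eq_bigr => r _; rewrite -scalerAl trZ mulrC.
rewrite De // [LHS]mulr_sumr mulrA /slice /of_ract [X in tr X]mulr_sumr [RHS]linear_sum.
apply: eq_bigr => i _ /=.
rewrite mul_tens_l tr_tens; congr (_ * _).
by rewrite -EM_l -/(tr _) -2!mulrA trC !mulrA.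
Qed.

Lemma slice_V v c : v \in Vcent -> c \in Acent ->
  slice (c * j (tunnel v)) = v * slice c.
Proof.
move=> hv hc; apply: ract_inj => m.
rewrite ractM (ract_V _ hv) !ract_slice ?rmorphM ?mulrA //.
by rewrite rpredM // U_sub_A // tunnel_U.
Qed.

(** [E_EM_comm] moves c to the right end, after which the sum over the dual
    bases of E is that of [EM (a m c)]. *)
Lemma lact_slice c m : c \in Acent -> lact (slice c) m = EM (a * j m * c).
Proof.
move=> hc; rewrite lact_of_ract -[RHS]dual_bases_r; apply: eq_bigr => i _.
by rewrite -!EM_r -EM_l -!mulrA (E_EM_comm _ hc) !mulrA.
Qed.

Lemma lact_VM v z m : v \in Vcent -> lact (v * z) m = lact z m * tunnel v.
Proof. by move=> hv; rewrite lactM lact_V. Qed.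

(** Expand [r.2] by [A_expand] and contract [r.1] by [sum_slice].  A factor
    [dualU p] in the argument of a slice comes out on the left as [val p.1], and
    acts on M by right multiplication; it meets [dualU' p] there, so that
    [sum_tunnel_dualU] removes the sum over f.  What remains is the expansion of
    [a m] along the dual bases al, al' of EM. *)
Lemma smash_relation m : \sum_(r <- D) j (lact r.1 m) * r.2 = a * j m.
Proof.
rewrite -[RHS](dbA _).1.
transitivity (\sum_(r <- D) \sum_i \sum_(p <- f)
    j (lact (tr (r.2 * (al i * j (dualU p))) *: r.1) m) * (j (dualU' p) * al' i)).
  rewrite big_seq [RHS]big_seq; apply: eq_bigr => r hr.
  case: hD => /(_ r hr)[_ h2] _; rewrite {1}(A_expand h2) mulr_sumr.
  apply: eq_bigr => i _; rewrite mulr_sumr; apply: eq_bigr => p _.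
  by rewrite linearZl_LR jZ -scalerAr -scalerAl.
rewrite exchange_big; apply: eq_bigr => i _ /=.
rewrite exchange_big /=.
transitivity (\sum_(p <- f) j (EM (a * j m * al i)) *
   j (tunnel (val (s * p.1)) * dualU' p) * al' i).
  apply: eq_bigr => p _; rewrite -mulr_suml -rmorph_sum -linear_sumlz /=.
  rewrite sum_slice; last by rewrite rpredM // U_sub_A // dualU_U.
  rewrite slice_V ?val_V // (mulrA (val s)) lact_VM; last by rewrite rpredM // val_V.
  by rewrite lact_slice // !rmorphM !mulrA.
by rewrite -mulr_suml -mulr_sumr -rmorph_sum sum_tunnel_dualU rmorph1 mulr1.
Qed.

Lemma V_comm (v : V) n : j n * val v = val v * j n.
Proof. by have /centralizer_rangeP-> := val_V v. Qed.

Lemma slice_j q c : slice (j q * c) = \sum_i tens (x i) (q * EM (c * j (y i) * a)).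
Proof. by apply: eq_bigr => i _; rewrite -!mulrA EM_l. Qed.

(** Here the factor [dualU' p] comes out of the slice and [val p.1] out of
    [flip]; moving the latter through [e1] turns it into an element of U standing
    next to [dualU' p], and [sum_tunnel_dualU] applies. *)
Lemma adjoint_action_term i m :
  \sum_(p <- f) \sum_(r <- D)
    (tr (r.2 * (j (dualU' p) * al' i)) *: r.1) * j m *
      (val s * flip (al i * j (dualU p)) * val w) =
  \sum_l val s * tens (x l) (lact (al i) (EM (al' i * j (y l) * a) * m)) * val w.
Proof.
transitivity (\sum_(p <- f) \sum_l val s *
    tens (x l) (tunnel (val (s * p.1)) * dualU' p * (EM (al' i * j (y l) * a) * m)) *
    flip (al i) * val w).
  apply: eq_bigr => p _; rewrite -!mulr_suml sum_slice; last first.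
    by rewrite rpredM // U_sub_A // dualU'_U.
  rewrite flipM ?flip_tunnel ?val_V ?U_sub_A ?dualU_U //.
  rewrite slice_j; move: (flip (al i)) => fl.
  rewrite !mulr_sumr !mulr_suml; apply: eq_bigr => l _.
  rewrite -[LHS]mulrA -[LHS]mulrA -[RHS]mulrA -[RHS]mulrA; congr (_ * _).
  rewrite !mulrA; congr (_ * _ * _).
  by rewrite j_tensr -mulrA -rmorphM mul_tens_V ?val_V // !mulrA.
rewrite exchange_big; apply: eq_bigr => l _ /=.
rewrite -!mulr_suml -mulr_sumr -linear_sumr -mulr_suml sum_tunnel_dualU mul1r.
by rewrite -(mulrA (val s)) mul_tens_r ract_flip.
Qed.

(** [r.2] is now expanded by [A_expand'].  As [flip] turns a left action into a
    right one, the sum over al, al' reassembles [(y_l a) |> m = y_l (a |> m)], and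
    the sum over l is the unit of M1. *)
Lemma adjoint_action m :
  \sum_(r <- D) r.1 * j m * (val s * flip r.2 * val w) = j (lact a m).
Proof.
transitivity (\sum_i \sum_(p <- f) \sum_(r <- D)
    (tr (r.2 * (j (dualU' p) * al' i)) *: r.1) * j m *
      (val s * flip (al i * j (dualU p)) * val w)).
  (* bring the sum over D outside, to expand each [r.2] separately *)
  under [RHS]eq_bigr => i _ do rewrite exchange_big /=.
  rewrite [RHS]exchange_big big_seq [RHS]big_seq; apply: eq_bigr => r hr /=.
  case: hD => /(_ r hr)[_ h2] _.
  rewrite {1}(A_expand' h2) (linear_sumE _ _ flip_linear) mulr_sumr mulr_suml mulr_sumr.
  apply: eq_bigr => i _; rewrite (linear_sumE _ _ flip_linear) mulr_sumr mulr_suml mulr_sumr.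
  apply: eq_bigr => p _.
  have flipZ b z : flip (b *: z) = b *: flip z.
    by have [h hh] := linear_as_hom flip_linear; rewrite -!hh linearZ.
  by rewrite flipZ -!scalerAr -!scalerAl -scalerAr.
under eq_bigr => i _ do rewrite adjoint_action_term.
rewrite exchange_big /=.
transitivity (val s * (\sum_l tens (x l) (y l) * j (lact a m)) * val w).
  rewrite mulr_sumr mulr_suml; apply: eq_bigr => l _.
  rewrite -mulr_suml -mulr_sumr -linear_sumr j_tensr; congr (_ * tens _ _ * _).
  rewrite -[RHS]lact_j -[RHS]lactM -[j (y l) * a in RHS](dbA _).2 linear_sumlz.
  by apply: eq_bigr => i _; rewrite /= lactM lact_j !mulrA.
by rewrite -mulr_suml -one_tens mul1r -V_comm -mulrA -rmorphM sw rmorph1 mulr1.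
Qed.

End Coproduct.

(** The functional [a |-> lam^-1 tr (a e1 w)] is the counit, so the left-hand
    side tests [eps_t(h)] against z: the target counit of h is [h |> 1], an
    element of U inside A. *)
Lemma counit_coproduct_one D h z : is_coproduct 1 D -> h \in Acent -> z \in Acent ->
  lam^-1 * \sum_(r <- D) tr (r.1 * (h * e1 * val w)) * tr (r.2 * z) =
  tr (j (lact h 1) * z).
Proof.
move=> [_ De] hh hz; rewrite De //; last first.
  rewrite rpredM ?(V_sub_A (val_V _)) // rpredM //.
  by apply/centralizer_rangeP => n; rewrite e1_iota.
rewrite mulKf // -(mulrA _ (val w)) -rmorphM ws rmorph1 mulr1.
have -> : j (lact h 1) * z =
    \sum_i j (lact h 1) * (z * j (iota (E (1 * x i)) * y i)).
  by rewrite -!mulr_sumr -rmorph_sum dual_bases_l rmorph1 mulr1.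
rewrite linear_sum; apply: eq_bigr => i _ /=; congr (tr _).
rewrite lactM lact_tens !mul1r -[iota _ in LHS]mul1r lact_iota !rmorphM !mulrA.
by congr (_ * _); rewrite -!mulrA; move/centralizer_rangeP: hz => ->.
Qed.

End Markov.
End BasicConstruction.

(** * Transport of the pairings from B to A *)

Section Tower.
Variables (k : fieldType) (N M M1 M2 : algType k).
Variables (iota : {lrmorphism N -> M}) (E : {linear M -> N}).
Variables (I : nat) (x y : 'I_I -> M) (lam : k) (T : {scalar N}).
Variables (tens1 : {bilinear M -> M -> M1}) (j1 : {lrmorphism M -> M1}).
Variable EM : {linear M1 -> M}.
Variables (tens2 : {bilinear M1 -> M1 -> M2}) (j2 : {lrmorphism M1 -> M2}).
Variable EM1 : {linear M2 -> M1}.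
Hypothesis hM1 : basic_construction iota E lam tens1 j1 EM.
Hypothesis hM2 : basic_construction j1 EM lam tens2 j2 EM1.
Hypothesis hmarkov : symmetric_markov_extension iota E x y lam T.

Local Notation Acent := (centralizer_pred (range (fun n => j1 (iota n)))).
Local Notation Bcent := (centralizer_pred (range (fun m => j2 (j1 m)))).
Local Notation V := (centralizer (range j1)).
Local Notation tr := (tr E EM T).
Local Notation e1 := (tens1 1 1).
Local Notation lact1 := (lact lam tens1 EM).
Local Notation ract2 := (ract lam tens2 EM1).

Let Ebi : bimodule_map iota E. Proof. by case: hmarkov => -[[[]]]. Qed.
Let db : dual_bases iota E x y. Proof. by case: hmarkov => -[[[]]]. Qed.
Let E1 : E 1 = 1. Proof. by case: hmarkov => -[[]]. Qed.
Let lam0 : lam != 0. Proof. by case: hmarkov => -[[]]. Qed.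
Let index : \sum_i x i * y i = lam^-1 *: 1. Proof. by case: hmarkov => -[[]]. Qed.
Let hT : is_trace T. Proof. by case: hmarkov => -[]. Qed.
Let hTE : is_trace (fun m => T (E m)). Proof. by case: hmarkov => -[]. Qed.
Let db2 := EM_dual_bases hM1 db lam0.

Lemma EM1_j2 z : EM1 (j2 z) = z.
Proof.
rewrite -[j2 z]mulr1 (EM_l hM2 db2 lam0) (EM_one hM2 db2 lam0) ?mulr1 //.
exact: (EM_dual_index hM1 db E1).
Qed.

Lemma trace2_tens a z : trace2 E T EM EM1 (tens2 a 1 * z) = lam * tr (a * ract2 z 1).
Proof.
rewrite (mul_tens_r hM2 db2 lam0) /trace2 /trace1 /trace0 (EM_tens hM2) !linearZ.
by [].
Qed.

Variables (s w : V).
Hypothesis sw : s * w = 1.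
Hypothesis ws : w * s = 1.

Local Notation pair := (pairing E lam T tens1 EM tens2 EM1 w).
Local Notation pair' := (pairing' E lam T tens1 EM tens2 EM1 w).

(** Since the right action of b on M1 is [lam^-1 EM1 (e2 z b)], this is
    [lam^-1 EM1 (e2 e1 w b)]. *)
Definition fourier (b : M2) : M1 := ract2 b (e1 * val w).

Lemma fourier1 : fourier 1 = e1 * val w.
Proof. by rewrite /fourier -(rmorph1 j2) (ract_j hM2 db2 lam0) mulr1. Qed.

Lemma pairing_tr (a : algA iota j1) (b : algB j1 j2) :
  pair a b = lam^-1 * tr (val a * fourier (val b)).
Proof.
have e2 : j2 (val a) * tens2 1 1 = tens2 (val a) 1.
  by rewrite (j_tensl hM2 db2) mulr1.
rewrite /pairing e2 -!mulrA trace2_tens expr2 invfM -mulrA mulKf //.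
by rewrite (mulrA (j2 _)) -rmorphM (ractM hM2 db2 lam0) (ract_j hM2 db2 lam0) mul1r.
Qed.

Lemma e1_A : e1 \in Acent.
Proof. by apply/centralizer_rangeP => n; rewrite (e1_iota hM1 db). Qed.

Lemma val_A (v : V) : val v \in Acent.
Proof. exact: V_sub_A (valP v). Qed.

Lemma fourier_A b : b \in Bcent -> fourier b \in Acent.
Proof.
move=> /centralizer_rangeP hb; apply/centralizer_rangeP => n; rewrite /fourier.
rewrite -(ract_iota hM2 db2 lam0) -[RHS]/(ract2 _ _).
have /centralizer_rangeP <- : e1 * val w \in Acent by rewrite rpredM ?e1_A ?val_A.
by rewrite -!(ract_j hM2 db2 lam0) -!(ractM hM2 db2 lam0) hb.
Qed.

(** [tens2 c d] commutes with N, so the Casimir element of M/N moves it into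
    the centralizer of M. *)
Lemma sum_B c d : c \in Acent -> d \in Acent ->
  \sum_i j2 (j1 (x i)) * tens2 c d * j2 (j1 (y i)) \in Bcent.
Proof.
move=> /centralizer_rangeP hc /centralizer_rangeP hd; apply/centralizer_rangeP => m.
have hz n : tens2 c d * j2 (j1 (iota n)) = j2 (j1 (iota n)) * tens2 c d.
  by rewrite (j_tensl hM2 db2) (j_tensr hM2 db2) -hc hd (tens_bal hM2).
by have /= -> := casimir_comm (h := j2 \o j1) db hz m.
Qed.

(** The element [lam^-1 w^-1 x_i e1 e2 c y_i] of B. *)
Definition inv_fourier (c : M1) : M2 :=
  lam^-1 *: \sum_i j2 (j1 (x i)) * tens2 (val s * e1) c * j2 (j1 (y i)).

Lemma inv_fourier_B c : c \in Acent -> inv_fourier c \in Bcent.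
Proof. by move=> hc; rewrite rpredZ // sum_B // rpredM ?e1_A ?val_A. Qed.

Lemma ract2_inv_fourier c z :
  ract2 (inv_fourier c) z = \sum_i j1 (lact1 (z * val s) (x i)) * c * j1 (y i).
Proof.
rewrite /inv_fourier linearZl_LR /= linear_sumlz scaler_sumr; apply: eq_bigr => i _ /=.
rewrite (j_tensl hM2 db2) (j_tensr hM2 db2) (ract_tens hM2 lam0) lactE.
rewrite (mulrA (j1 (x i))) V_comm -(mulrA (val s)) (j_tensl hM1 db) mulr1 !mulrA.
by rewrite linearZ /= -!scalerAl.
Qed.

Lemma sum_iota_E (c : M1) : c \in Acent ->
  \sum_i j1 (iota (E (x i))) * c * j1 (y i) = c.
Proof.
move=> /centralizer_rangeP hc; rewrite -[RHS]mulr1 -(rmorph1 j1) -(dual_bases_l db 1).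
rewrite rmorph_sum mulr_sumr; apply: eq_bigr => i _.
by rewrite mul1r -hc rmorphM mulrA.
Qed.

Lemma lact1_e1 m : lact1 e1 m = iota (E m).
Proof. by rewrite (lact_tens hM1 lam0) !mul1r. Qed.

Lemma inv_fourierK c : c \in Acent -> fourier (inv_fourier c) = c.
Proof.
move=> hc; rewrite /fourier ract2_inv_fourier -[RHS]sum_iota_E //.
apply: eq_bigr => i _.
by rewrite -(mulrA e1) -rmorphM ws rmorph1 mulr1 lact1_e1.
Qed.

(** The right action is anti-multiplicative, so multiplying by
    [inv_fourier c] acts on [fourier b]; the result is the convolution on A. *)
Lemma fourier_mul b c :
  fourier (b * inv_fourier c) =
  \sum_i j1 (lact1 (fourier b * val s) (x i)) * c * j1 (y i).
Proof. by rewrite /fourier (ractM hM2 db2 lam0) ract2_inv_fourier. Qed.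

Lemma pairing_inv_fourier (a : algA iota j1) c (hc : c \in Acent) :
  pair a (Centralizer (inv_fourier_B hc)) = lam^-1 * tr (val a * c).
Proof. by rewrite pairing_tr /= inv_fourierK. Qed.

Lemma coproduct_tr (Delta : algA iota j1 -> seq (algA iota j1 * algA iota j1)) :
  (forall (a : algA iota j1) (b b' : algB j1 j2),
     \sum_(p <- Delta a) pair p.1 b * pair p.2 b' = pair a (b * b')) ->
  forall a, is_coproduct iota E x y lam tens1 EM T s (val a)
    [seq (val p.1, val p.2) | p <- Delta a].
Proof.
move=> hDelta a; split.
  by move=> _ /mapP[p _ ->]; split; apply: valP.
move=> c c' hc hc'.
have := hDelta a (Centralizer (inv_fourier_B hc)) (Centralizer (inv_fourier_B hc')).
rewrite pairing_tr /= fourier_mul inv_fourierK // big_map => h.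
transitivity (lam ^+ 2 * (\sum_(p <- Delta a)
    (lam^-1 * tr (val p.1 * c)) * (lam^-1 * tr (val p.2 * c')))).
  rewrite mulr_sumr; apply: eq_bigr => p _ /=.
  by rewrite (mulrACA lam^-1) -invfM [RHS]mulrA mulfV ?mul1r // mulf_neq0.
transitivity (lam ^+ 2 * (\sum_(p <- Delta a)
    pair p.1 (Centralizer (inv_fourier_B hc)) *
    pair p.2 (Centralizer (inv_fourier_B hc')))).
  by congr (_ * _); apply: eq_bigr => p _; rewrite !pairing_inv_fourier.
rewrite h expr2 -mulrA mulVKf //; congr (_ * _).
rewrite mulr_sumr (linear_sumE _ _ (tr_linear E EM T)); apply: eq_bigr => i _.
by rewrite !mulrA.
Qed.

(** The element [lam^-1 x_i c w^-1 e2 e1 y_i] of B, which represents c for the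
    second pairing as [inv_fourier c] does for the first. *)
Definition inv_fourier' (c : M1) : M2 :=
  lam^-1 *: \sum_i j2 (j1 (x i)) * tens2 (c * val s) e1 * j2 (j1 (y i)).

Lemma inv_fourier'_B c : c \in Acent -> inv_fourier' c \in Bcent.
Proof. by move=> hc; rewrite rpredZ // sum_B ?rpredM ?e1_A ?val_A. Qed.

Lemma inv_fourier'_tens c d : c \in Acent ->
  inv_fourier' c * tens2 e1 d = tens2 (c * val s) d.
Proof.
move=> hc; have /centralizer_rangeP hcs : c * val s \in Acent.
  by rewrite rpredM ?val_A.
have -> : c * val s = \sum_i j1 (x i) * (c * val s) * j1 (iota (E (y i))).
  under eq_bigr => i _ do rewrite -mulrA hcs mulrA -rmorphM.
  rewrite -mulr_suml -rmorph_sum.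
  by under eq_bigr => i _ do rewrite -[y i]mulr1; rewrite dual_bases_r // rmorph1 mul1r.
rewrite /inv_fourier' -scalerAl mulr_suml linear_sumlz scaler_sumr.
apply: eq_bigr => i _ /=.
rewrite (j_tensl hM2 db2) (j_tensr hM2 db2) (tens_mul hM2) (j_tensr hM1 db).
rewrite (tens_mul hM1) (EM_tens hM1) !mul1r !mulr1 linearZ /= -scalerAr.
by rewrite linearZl_LR scale_lamK.
Qed.

Lemma pairing'_tr (a : algA iota j1) c (hc : c \in Acent) :
  pair' a (Centralizer (inv_fourier'_B hc)) = lam^-1 * tr (val a * c).
Proof.
rewrite /pairing' /= -(mulrA _ (j2 (val w))) -rmorphM -mulrA (j_tensr hM2 db2).
rewrite mul1r -mulrA (j_tensl hM2 db2) mulr1 inv_fourier'_tens //.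
rewrite /trace2 /trace1 /trace0 (EM_tens hM2) !linearZ /=.
rewrite expr2 invfM -mulrA mulKf //; congr (_ * _).
rewrite -/(tr _) mulrA -(mulrA c (val s)) -[val s * val w]rmorphM sw rmorph1 mulr1.
exact: (trC hM1 Ebi db lam0 hT hTE).
Qed.

Lemma fourier_inv_fourier' c :
  fourier (inv_fourier' c) = flip x y lam tens1 EM (val w * c * val s).
Proof.
rewrite /fourier /inv_fourier' linearZl_LR /= linear_sumlz scaler_sumr.
apply: eq_bigr => i _ /=.
rewrite (j_tensl hM2 db2) (j_tensr hM2 db2) (ract_tens hM2 lam0).
rewrite (j_tensr hM1 db) (j_tensl hM1 db) mulr1 mul1r ractE linearZl_LR.
congr (_ *: tens1 (EM _) _).
by rewrite !mulrA -(mulrA e1 (val w)) -V_comm mulrA (j_tensr hM1 db) mul1r.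
Qed.

Variable f : seq (V * V).
Hypothesis hf : symmetric_separability_element f.
Hypothesis hs : s = \sum_(p <- f) trace2 E T EM EM1 (j2 (val p.2)) *: p.1.
Hypothesis hphi : forall u, u \in centralizer_pred (range iota) ->
  T (E u) = T (E (EM (untunnel x y tens1 u))).
Variables (J : nat) (al al' : 'I_J -> M1).
Hypothesis al_A : forall i, al i \in Acent.
Hypothesis dbA : dual_bases j1 EM al al'.

Let hs1 : s = \sum_(p <- f) tr (val p.2) *: p.1.
Proof.
rewrite hs; apply: eq_bigr => p _.
by rewrite /trace2 /trace1 /trace0 EM1_j2.
Qed.

(** Choose b with [SB b = inv_fourier' c].  Comparing the two pairings gives
    [fourier b = c], and the two conditions on S then say that [S a] against c
    has the trace of a against [flip (w c s)].  As [flip] is an involutive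
    anti-automorphism preserving tr, this is the trace of [s (flip a) w]
    against c. *)
Lemma antipode_flip (SB : algB j1 j2 -> algB j1 j2)
    (S : algA iota j1 -> algA iota j1) :
  bijective SB ->
  (forall (a : algA iota j1) (b : algB j1 j2), pair a b = pair' a (SB b)) ->
  (forall (a : algA iota j1) (b : algB j1 j2), pair (S a) b = pair a (SB b)) ->
  forall a, val (S a) = val s * flip x y lam tens1 EM (val a) * val w.
Proof.
move=> [SB' _ SBK] hSB hS a.
pose fl := flip x y lam tens1 EM.
pose trc := trC hM1 Ebi db lam0 hT hTE.
have flA c : c \in Acent -> fl c \in Acent.
  exact: (flip_A hM1 Ebi db lam0 hT hTE hphi hf hs1 sw ws al_A dbA).
apply: (tr_nondeg hM1 Ebi db lam0 hT hTE hphi hf hs1 sw ws al_A dbA).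
- exact: valP.
- by rewrite !rpredM ?val_A // flA //; apply: valP.
have pairE (a' : algA iota j1) (b : algB j1 j2) :
    tr (val a' * fourier (val b)) = lam * pair a' b.
  by rewrite pairing_tr mulVKf.
move=> c hc; set b := SB' (Centralizer (inv_fourier'_B hc)).
have fb : fourier (val b) = c.
  apply: (tr_nondeg hM1 Ebi db lam0 hT hTE hphi hf hs1 sw ws al_A dbA) => // [|z hz].
    by apply: fourier_A; apply: valP.
  rewrite trc [RHS]trc (pairE (Centralizer hz)) hSB SBK pairing'_tr /=.
  by rewrite mulVKf.
rewrite -{1}fb pairE hS SBK -pairE /= fourier_inv_fourier' -/(fl _).
have aA : val a \in Acent by apply: valP.
have wcsA : val w * c * val s \in Acent by rewrite !rpredM ?val_A.
pose flipK' := flipK hM1 Ebi db lam0 hT hTE hphi hf hs1 sw ws al_A dbA.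
rewrite -{1}(flipK' _ aA) -/(fl _) -(flipM hM1 db lam0) ?flA //.
rewrite (tr_flip hM1 Ebi db lam0 hT hTE hphi) ?rpredM ?flA ?val_A //.
by rewrite -2!mulrA -[LHS]trc [RHS]trc; congr (tr _); rewrite !mulrA.
Qed.

End Tower.

Theorem proposition4p5
  (k : fieldType) (N M M1 M2 : algType k)
  (iota : {lrmorphism N -> M}) (E : {linear M -> N})
  (I : nat) (x y : 'I_I -> M) (lam : k) (T : {scalar N})
  (* the Jones tower *)
  (tens1 : {bilinear M -> M -> M1}) (j1 : {lrmorphism M -> M1})
  (EM : {linear M1 -> M})
  (tens2 : {bilinear M1 -> M1 -> M2}) (j2 : {lrmorphism M1 -> M2})
  (EM1 : {linear M2 -> M1})
  (hM1 : basic_construction iota E lam tens1 j1 EM)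
  (hM2 : basic_construction j1 EM lam tens2 j2 EM1)
  (* the standing assumptions *)
  (hmarkov : symmetric_markov_extension iota E x y lam T)
  (hsym : symmetric_product iota E lam T tens1 EM x y)
  (hirr : weakly_irreducible iota E T)
  (hdepth : depth_two iota j1 EM j2 EM1)
  (* the weak Hopf algebra structure of A *)
  (f : seq (algV j1 * algV j1)) (w : algV j1)
  (hf : symmetric_separability_element f)
  (hw : is_w E T EM j2 EM1 f w) :
  let pair := pairing E lam T tens1 EM tens2 EM1 w in
  let pair' := pairing' E lam T tens1 EM tens2 EM1 w in
  forall
  (SB : {linear algB j1 j2 -> algB j1 j2})
  (hSB_bij : bijective SB)
  (hSB : forall (a : algA iota j1) (b : algB j1 j2),
     pair a b = pair' a (SB b))
  (Delta : algA iota j1 -> seq (algA iota j1 * algA iota j1))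
  (hDelta : forall (a : algA iota j1) (b b' : algB j1 j2),
     \sum_(p <- Delta a) pair p.1 b * pair p.2 b' = pair a (b * b'))
  (S : {linear algA iota j1 -> algA iota j1})
  (hS : forall (a : algA iota j1) (b : algB j1 j2),
     pair (S a) b = pair a (SB b)),
  exists act : algA iota j1 -> M -> M,
    (forall a m,
       j1 (act a m) = \sum_(p <- Delta a) val p.1 * j1 m * val (S p.2)) /\
    left_module_algebra Delta (fun a => pair a 1) act.
Proof.
move=> pair pair' SB hSB_bij hSB Delta hDelta S hS.
have [[[[Ebi db] _ lam0 _] hT _ hTE] hU] := hmarkov.
have [s_w w_s] := hw.
set s := \sum_(p <- f) _ in s_w w_s.
have [[J [al [al' dbA]]] _] := hdepth.
have hUE u : u \in centralizer_pred (range iota) -> forall m, E (u * m) = E (m * u).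
  by move=> hu m; apply: (hU (Centralizer hu)).
(* under the first alternative, the trace property moves [x i] around to [y i] *)
have hphi u : u \in centralizer_pred (range iota) ->
    T (E u) = T (E (EM (untunnel x y tens1 u))).
  move=> hu; case: hsym => [hyx | h]; last exact: (h (Centralizer hu)).
  rewrite /untunnel /of_lact linear_sum.
  under eq_bigr => i _ do rewrite /= (EM_tens hM1).
  rewrite -scaler_sumr !linearZ /=.
  have -> : T (E (\sum_i x i * u * y i)) = T (E (u * \sum_i y i * x i)).
    rewrite mulr_sumr !linear_sum; apply: eq_bigr => i _ /=.
    by rewrite -mulrA [u * (_ * _)]mulrA; apply: (hTE (x i) (u * y i)).
  by rewrite hyx -scalerAr !linearZ /= mulr1 mulVKf.
have alA i : val (al i) \in centralizer_pred (range (fun n => j1 (iota n))).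
  exact: valP.
have al'A i : val (al' i) \in centralizer_pred (range (fun n => j1 (iota n))).
  exact: valP.
have hs1 : s = \sum_(p <- f) tr E EM T (val p.2) *: p.1.
  apply: eq_bigr => p _; rewrite /trace2 /trace1 /trace0.
  by rewrite (EM1_j2 hM1 hM2 hmarkov).
have hcop := coproduct_tr hM1 hM2 hmarkov w_s hDelta.
have hflip := antipode_flip hM1 hM2 hmarkov s_w w_s hf erefl hphi alA dbA hSB_bij hSB hS.
pose lct := lact lam tens1 EM.
exists (fun a m => lct (val a) m); split.
  move=> a m.
  rewrite -(adjoint_action hM1 Ebi db lam0 hT hTE hUE hphi hf hs1 s_w w_s
              alA al'A dbA (valP a) (hcop a) m).
  by rewrite big_map; apply: eq_bigr => p _ /=; rewrite hflip.
split.
- by move=> m c a b; apply: lact_is_linear_l.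
- move=> a; exact: lact_is_linear_r.
- by move=> m; rewrite rmorph1 -(rmorph1 j1) /lct (lact_j hM1 db lam0) mul1r.
- by move=> g h m; rewrite rmorphM /lct (lactM hM1 db lam0).
- move=> h m n.
  have := smash_relation hM1 Ebi db lam0 hT hTE hUE hphi hf hs1 s_w w_s
            alA dbA (valP h) (hcop h) m.
  rewrite big_map => e.
  rewrite /lct -(lact_j hM1 db lam0 m n) -(lactM hM1 db lam0) -e linear_sumlz.
  by apply: eq_bigr => p _; rewrite /= (lactM hM1 db lam0) (lact_j hM1 db lam0).
move=> h.
(* the target counit of h acts on 1 as multiplication by the element [h |> 1] *)
suff -> : val (target_counit Delta (fun a => pair a 1) h) = j1 (lct (val h) 1).
  by rewrite /lct (lact_j hM1 db lam0) mulr1.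
have hA : val h \in centralizer_pred (range (fun n => j1 (iota n))) := valP h.
apply: (tr_nondeg hM1 Ebi db lam0 hT hTE hphi hf hs1 s_w w_s alA dbA).
- exact: valP.
- by apply: U_sub_A; apply: (lact_U hM1 db lam0 hA).
move=> z hz.
have hcop1 : is_coproduct iota E x y lam tens1 EM T s 1
    [seq (val p.1, val p.2) | p <- Delta 1].
  by have := hcop 1; rewrite rmorph1.
rewrite -(counit_coproduct_one hM1 db lam0 w_s hcop1 hA hz).
rewrite /target_counit linear_sum mulr_suml (linear_sumE _ _ (tr_linear E EM T)).
rewrite mulr_sumr big_map; apply: eq_bigr => p _.
rewrite /pair (pairing_tr hM1 hM2 hmarkov).
rewrite rmorph1 (fourier1 hM1 hM2 hmarkov) rmorphM /=.
by rewrite -scalerAl trZ !mulrA.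
Qed.
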